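(* Let $n\ge2$, let $H^{(n)}$ be the $n$-step exceptional Bannai-Ito operator built from eigenfunctions $\phi^{(1)}_1,\ldots,\phi^{(1)}_n$ of the Bannai-Ito operator $H$ with eigenvalues $\mu_1,\ldots,\mu_n$ (as defined in the context), and let $\phi^{(1)}_m$ be an eigenfunction of $H$ with eigenvalue $\mu_m$. Then the eigenfunction $\phi^{(n+1)}_m=\mathcal F^{(n)}\circ\cdots\circ\mathcal F^{(1)}[\phi^{(1)}_m]$ of $H^{(n)}$ can be expressed through a $3\times3$ determinant as $$\phi^{(n+1)}_m(x)=\prod_{j=1}^{n-2}\frac{\mu_m-\mu_j}{\mu_n-\mu_j}\; \begin{vmatrix} \mu_m\tilde\chi^{(1)}_m(x)&\tilde\chi^{(1)}_m(x)&\tilde\chi^{(1)}_m(-x)\\ \mu_n\tilde\chi^{(1)}_n(x)&\tilde\chi^{(1)}_n(x)&\tilde\chi^{(1)}_n(-x)\\ \mu_{n-1}\tilde\chi^{(1)}_{n-1}(x)&\tilde\chi^{(1)}_{n-1}(x)&\tilde\chi^{(1)}_{n-1}(-x) \end{vmatrix}\cdot \left[(\mu_n-\mu_{n-1})\tilde\chi^{(1)}_n(x)\begin{vmatrix}\tilde\chi^{(1)}_n(x)&\tilde\chi^{(1)}_n(-x)\\ \tilde\chi^{(1)}_{n-1}(x)&\tilde\chi^{(1)}_{n-1}(-x)\end{vmatrix}\right]^{-1},$$ where, for every index $k$, $H[\phi^{(1)}_k(x)]=\mu_k\phi^{(1)}_k(x)$ and $$\tilde\chi^{(1)}_k(x)=\beta(-x-1)\phi^{(1)}_k(x)+\beta(x)\phi^{(1)}_k(-x-1).$$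 (For $n=2$ the product is empty and equals $1$.)
   Context: The operators act on functions of $x$ by $R[f(x)]=f(-x)$, $T[f(x)]=f(x+1)$, $I[f(x)]=f(x)$, so $TR[f(x)]=f(-x-1)$. A function standing to the left or right of an operator denotes multiplication by that function; products are compositions. Functions are taken in a field of functions of $x$ containing the rational functions and closed under $x\mapsto -x$, $x\mapsto x+1$ (for example meromorphic functions). Bannai-Ito operator (real parameters $\rho_1,\rho_2,r_1,r_2$): $H=H^{(0)}=\alpha(x)(R-I)+\beta(x)(TR-I)$ with $$\alpha(x)=\alpha^{(0)}(x)=\frac{(x-\rho_1)(x-\rho_2)}{-2x},\qquad \beta(x)=\beta^{(0)}(x)=\frac{(x-r_1+1/2)(x-r_2+1/2)}{2x+1},\qquad \gamma^{(0)}=0.$$ Subscripts merely label different eigenfunctions (they are not degrees). Let $\phi^{(1)}_1,\ldots,\phi^{(1)}_n$ be eigenfunctions of $H$ with pairwise distinct eigenvalues $\mu_1,\ldots,\mu_n$. For $1\le k\le n$, given $H^{(k-1)}=\alpha^{(k-1)}(x)(R-I)+\beta^{(k-1)}(x)(TR-I)+\gamma^{(k-1)}(x)$, the $k$-th seed solution is $\phi^{(k)}_k=\mathcal F^{(k-1)}\circ\cdots\circ\mathcal F^{(1)}[\phi^{(1)}_k]$, and $$\chi^{(k)}(x)=\phi^{(k)}_k(x)-\phi^{(k)}_k(-x),\qquad \tilde\chi^{(k)}(x)=\beta^{(k-1)}(-x-1)\phi^{(k)}_k(x)+\beta^{(k-1)}(x)\phi^{(k)}_k(-x-1),$$ assumed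 not identically zero, $$\mathcal F^{(k)}=\frac1{\chi^{(k)}(x)}(R-I)+\frac1{\tilde\chi^{(k)}(x)}(TR+I)\beta^{(k-1)}(-x-1),$$ and $H^{(k)}=\alpha^{(k)}(x)(R-I)+\beta^{(k)}(x)(TR-I)+\gamma^{(k)}(x)$ with $$\alpha^{(k)}(x)=\frac{\tilde\chi^{(k)}(-x)}{\chi^{(k)}(x)},\quad \beta^{(k)}(x)=\frac{\alpha^{(k-1)}(-x-1)\beta^{(k-1)}(x)\chi^{(k)}(-x-1)}{\tilde\chi^{(k)}(x)},\quad \gamma^{(k)}(x)=\frac{\tilde\chi^{(k)}(-x)-\tilde\chi^{(k)}(x)}{\chi^{(k)}(x)}+\gamma^{(k-1)}(x).$$ These satisfy $\mathcal F^{(k)}\circ H^{(k-1)}=H^{(k)}\circ\mathcal F^{(k)}$. *)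

(* Defs.v *)
From mathcomp Require Import all_boot all_order all_algebra.
Set Implicit Arguments.
Unset Strict Implicit.
Unset Printing Implicit Defensive.
Import Order.TTheory GRing.Theory Num.Theory.
Local Open Scope ring_scope.

(* A field of functions of x over the constants C (e.g. C real or complex):
   it contains the rational functions C(x) and is closed under the
   substitutions R[f](x) = f(-x) and T[f](x) = f(x+1).  Elements such as
   meromorphic functions have no value at every point, so the substitutions are
   given as ring morphisms, which on polynomials are the usual compositions. *)
Record functionField (C : numFieldType) := FunctionField {
  ff_sort :> fieldType;
  ff_rat : {rmorphism {fraction {poly C}} -> ff_sort};
  ff_R : {rmorphism ff_sort -> ff_sort};
  ff_T : {rmorphism ff_sort -> ff_sort};
  ff_R_poly : forall p : {poly C},
    ff_R (ff_rat (tofrac p)) = ff_rat (tofrac (p \Po (- 'X)));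
  ff_T_poly : forall p : {poly C},
    ff_T (ff_rat (tofrac p)) = ff_rat (tofrac (p \Po ('X + 1)));
  (* - (- x) = x *)
  ff_RR : forall f : ff_sort, ff_R (ff_R f) = f;
  (* - (- x - 1) - 1 = x *)
  ff_TRTR : forall f : ff_sort, ff_T (ff_R (ff_T (ff_R f))) = f
}.

Section BannaiIto.
Variables (C : numFieldType) (K : functionField C).
Implicit Types (f psi : K).

Definition cst (c : C) : K := ff_rat K (tofrac c%:P).
Definition var : K := ff_rat K (tofrac 'X).

Definition Rop f : K := ff_R K f.
(* TR[f](x) = f(-x-1) *)
Definition TRop f : K := ff_T K (ff_R K f).

(* The operator alpha (R - I) + beta (TR - I) + gamma. *)
Record biOp := BiOp { bi_alpha : K; bi_beta : K; bi_gamma : K }.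

Definition biApp (H : biOp) f : K :=
  bi_alpha H * (Rop f - f) + bi_beta H * (TRop f - f) + bi_gamma H * f.

Definition eigenfunction (H : biOp) (mu : C) f : Prop :=
  f != 0 /\ biApp H f = cst mu * f.

Definition bannaiIto (rho1 rho2 r1 r2 : C) : biOp :=
  {| bi_alpha := (var - cst rho1) * (var - cst rho2) / (- 2 * var);
     bi_beta := (var - cst r1 + 2^-1) * (var - cst r2 + 2^-1) / (2 * var + 1);
     bi_gamma := 0 |}.

(* In the next four definitions H is H^(k-1) and psi is the k-th seed. *)
Definition chi psi : K := psi - Rop psi.

Definition chit (H : biOp) psi : K :=
  TRop (bi_beta H) * psi + bi_beta H * TRop psi.

Definition Fop (H : biOp) psi f : K :=
  (chi psi)^-1 * (Rop f - f)
  + (chit H psi)^-1 * (TRop (TRop (bi_beta H) * f) + TRop (bi_beta H) * f).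

Definition biStep (H : biOp) psi : biOp :=
  {| bi_alpha := Rop (chit H psi) / chi psi;
     bi_beta := TRop (bi_alpha H) * bi_beta H * TRop (chi psi) / chit H psi;
     bi_gamma := (Rop (chit H psi) - chit H psi) / chi psi + bi_gamma H |}.

(* Seeds are indexed from 1: [phi k] is phi^(1)_k, and phi 0 is never used.
   [biChain H phi k] is the pair (H^(k), F^(k) o ... o F^(1)). *)
Fixpoint biChain (H : biOp) (phi : nat -> K) (k : nat) : biOp * (K -> K) :=
  if k is k'.+1 then
    let: (Hk, Fk) := biChain H phi k' in
    let psi := Fk (phi k) in
    (biStep Hk psi, fun f => Fop Hk psi (Fk f))
  else (H, id).

Definition biH (H : biOp) (phi : nat -> K) k : biOp := (biChain H phi k).1.
Definition biF (H : biOp) (phi : nat -> K) k : K -> K := (biChain H phi k).2.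

(* phi^(k)_k, chi^(k) and chi-tilde^(k), for k >= 1 *)
Definition seed H phi k : K := biF H phi k.-1 (phi k).
Definition chiAt H phi k : K := chi (seed H phi k).
Definition chitAt H phi k : K := chit (biH H phi k.-1) (seed H phi k).

End BannaiIto.

Definition mxOfRows (F : fieldType) (m n : nat) (s : seq (seq F)) : 'M[F]_(m, n) :=
  \matrix_(i < m, j < n) nth 0 (nth [::] s i) j.

(* Main.v *)
Require Import Defs.
From HB Require Import structures.
From mathcomp Require Import all_boot all_order all_algebra.
From mathcomp Require Import ring.
Set Implicit Arguments.
Unset Strict Implicit.
Unset Printing Implicit Defensive.
Import Order.TTheory GRing.Theory Num.Theory.
Local Open Scope ring_scope.

(** Write [S = TR], [c_f = chi f] and [t_f = chit H f] for an operator [H] with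
    coefficients alpha, beta, gamma.  Both [R] and [S] are involutions,
    [c_f] is [R]-odd and [t_f] is [S]-even, and the intertwiner is
    [F f = t_f / t_psi - c_f / c_psi].

    The point is that alpha + R alpha, beta + S beta and gamma are constants
    A, B and g ([balanced]), both for the Bannai-Ito operator and, by
    [biStep_balanced], for every operator obtained from it by steps whose
    seeds are eigenfunctions.  For such an operator,
    the eigenvalue equation of f reads
      [alpha c_f = t_f - (mu + B - g) f]
    and applying R and S to it gives two relations free of f:
      [t_f - R t_f = (mu + A + B - g) c_f]                  ([chit_sub_Rop]),
      [alpha (S beta) c_f + (S alpha) beta (S c_f) = (g - mu) t_f]
                                                          ([alpha_beta_chi]).
    The first shows that the new gamma is constant and, with the second, that
    F maps eigenfunctions to eigenfunctions ([biApp_Fop]).  The second is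
    also the reason for the shape of the theorem: it says that a step with a
    seed of eigenvalue mu_1 acts on chi-tilde by mere division,
      [t'_(F f) = (mu - mu_1) t_f / t_psi]                        ([chit_Fop]).

    Consequently, after n - 2 steps the chi-tilde functions of f and of the
    last two seeds are the initial ones, divided by one common function G and
    multiplied by the constants prod_j (mu_k - mu_j) ([chit_biChain]).  Two
    more steps give a ratio of Casorati-like determinants in these three
    functions ([two_steps]).  That ratio is homogeneous of degree 0 in the
    last-but-one seed, 1 in f, -1 in the last seed and 0 in G, so
    that only prod_j (mu_m - mu_j) / (mu_n - mu_j) survives. *)

(** * The two reflections of the field of functions *)

Section Substitutions.
Variables (C : numFieldType) (K : functionField C).
Implicit Types (f : K) (c : C).

HB.instance Definition _ := GRing.RMorphism.copy (@Rop C K) (ff_R K).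
HB.instance Definition _ :=
  GRing.RMorphism.copy (@TRop C K) (ff_T K \o ff_R K).
HB.instance Definition _ := GRing.RMorphism.copy (@cst C K)
  (ff_rat K \o (@tofrac _) \o (@polyC C)).

Lemma RopK f : Rop (Rop f) = f.
Proof. exact: ff_RR. Qed.

Lemma TRopK f : TRop (TRop f) = f.
Proof. exact: ff_TRTR. Qed.

Lemma Rop_cst c : Rop (cst K c) = cst K c.
Proof. by rewrite /Rop /cst ff_R_poly comp_polyC. Qed.

Lemma TRop_cst c : TRop (cst K c) = cst K c.
Proof.
by rewrite /TRop -[ff_R K _]/(Rop _) Rop_cst /cst ff_T_poly comp_polyC.
Qed.

Lemma Rop_var : Rop (var K) = - var K.
Proof. by rewrite /Rop /var ff_R_poly comp_polyX !rmorphN. Qed.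

Lemma TRop_var : TRop (var K) = - var K - 1.
Proof.
rewrite /TRop -[ff_R K _]/(Rop _) Rop_var rmorphN /= /var ff_T_poly comp_polyX.
by rewrite !rmorphD !rmorph1 opprD.
Qed.

Lemma var_neq0 : var K != 0.
Proof. by rewrite fmorph_eq0 tofrac_eq0 polyX_eq0. Qed.

Lemma two_neq0 : 2 != 0 :> K.
Proof. by rewrite -(rmorph_nat (@cst C K)) fmorph_eq0 pnatr_eq0. Qed.

(** If 2x + 1 vanished, so would its image 1 - 2x under R, and their sum 2. *)
Lemma var2_neq0 : 2 * var K + 1 != 0.
Proof.
apply: contra_neq two_neq0 => e.
have := congr1 (@Rop C K) e.
rewrite rmorphD rmorphM /= Rop_var rmorph_nat rmorph1 rmorph0 => e'.
by rewrite -[RHS]add0r -{1}e -e'; ring.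
Qed.

End Substitutions.

(** * One step on an operator with constant reflection sums *)

Section Darboux.
Variables (C : numFieldType) (K : functionField C).
Implicit Types (H : biOp K) (f psi : K) (mu : C).

(** The invariant of the chain: a step by an eigenfunction preserves it, with
    new constants, whereas the shape of the rational coefficients is lost. *)
Definition balanced H (A B g : C) : Prop :=
  [/\ bi_alpha H + Rop (bi_alpha H) = cst K A,
      bi_beta H + TRop (bi_beta H) = cst K B & bi_gamma H = cst K g].

Lemma Rop_chi f : Rop (chi f) = - chi f.
Proof. by rewrite /chi rmorphB /= RopK opprB. Qed.

Lemma TRop_chit H f : TRop (chit H f) = chit H f.
Proof. by rewrite /chit rmorphD !rmorphM /= !TRopK addrC. Qed.

(** Both terms of the intertwiner are quotients of the two quantities attached
    to f by those attached to the seed; in particular it kills the seed. *)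
Lemma FopE H psi f :
  Fop H psi f = chit H f / chit H psi - chi f / chi psi.
Proof. rewrite /Fop /(chi f) rmorphM /= TRopK [chit H f]addrC; ring. Qed.

Section Eigen.
Variables (H : biOp K) (A B g : C).
Hypothesis balH : balanced H A B g.

Lemma alpha_chi mu f : biApp H f = cst K mu * f ->
  bi_alpha H * chi f = chit H f - cst K (mu + B - g) * f.
Proof.
case: balH => _ bB gE fE.
rewrite !rmorphD rmorphN /= -bB -gE 2!mulrDl mulNr -fE /biApp /chi /chit; ring.
Qed.

(** Applying R to [alpha_chi] and subtracting eliminates f itself, because
    R changes the sign of [chi f] and alpha + R alpha is constant. *)
Lemma chit_sub_Rop mu f : biApp H f = cst K mu * f ->
  chit H f - Rop (chit H f) = cst K (mu + (A + B - g)) * chi f.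
Proof.
move=> fE; have aE := alpha_chi fE; case: balH => aA _ _.
have /(canRL (subrK _)) -> : chit H f - cst K (mu + B - g) * f
  = bi_alpha H * chi f by rewrite aE.
rewrite [Rop _]rmorphD !rmorphM /= Rop_chi Rop_cst.
have /(canRL (addKr _)) -> := aA.
by rewrite !(rmorphD, rmorphN) /= /chi; ring.
Qed.

(** Multiply [alpha_chi] by S beta and its image under S by beta: since
    [chit H f] is S-invariant, the f-terms add up to a multiple of
    [chit H f]. Such left sides, for f and for the seed, are what remains
    of [chit] of the next operator. *)
Lemma alpha_beta_chi mu f : biApp H f = cst K mu * f ->
  bi_alpha H * TRop (bi_beta H) * chi f
  + TRop (bi_alpha H) * bi_beta H * TRop (chi f) = cst K (g - mu) * chit H f.
Proof.
move=> fE; have aE := alpha_chi fE; case: balH => _ bB _.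
have := congr1 (@TRop C K) aE.
rewrite rmorphM [TRop (_ - _)]rmorphB rmorphM /= TRop_chit TRop_cst => SaE.
rewrite mulrAC aE [_ * bi_beta H * _]mulrAC SaE.
have := congr1 (fun u => u * chit H f) bB.
rewrite !(rmorphD, rmorphN) /= => /= bBt.
have -> : (cst K g - cst K mu) * chit H f
  = cst K B * chit H f - (cst K mu + cst K B - cst K g) * chit H f by ring.
rewrite -bBt /chit; ring.
Qed.

Variables (mu1 : C) (psi : K).
Hypothesis psiE : biApp H psi = cst K mu1 * psi.
Hypotheses (chi0 : chi psi != 0) (chit0 : chit H psi != 0).

(** The sum for the new beta is [alpha_beta_chi] at the seed divided by its
    chi-tilde; the sum for the new alpha and the new gamma both come from
    [chit_sub_Rop] at the seed, divided by its [chi]. *)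
Lemma biStep_balanced :
  balanced (biStep H psi) (- (mu1 + (A + B - g))) (g - mu1)
                          (g - (mu1 + (A + B - g))).
Proof.
have /(canRL (subKr _)) tE := chit_sub_Rop psiE.
have abE := alpha_beta_chi psiE.
case: balH => _ _ gE; split=> /=.
- rewrite fmorph_div /= RopK Rop_chi tE rmorphN /=.
  by field; rewrite oppr_eq0 chi0.
- rewrite fmorph_div !rmorphM /= !TRopK TRop_chit -mulrDl.
  apply: (canLR (mulfK chit0)); rewrite -abE; ring.
- rewrite gE tE !(rmorphB,rmorphD) /=; by field.
Qed.

(** The [chi]-quotient in the intertwiner is R-invariant, being a ratio of two
    R-odd functions, and drops out. *)
Lemma chi_Fop f :
  chi (Fop H psi f) = chit H f / chit H psi - Rop (chit H f) / Rop (chit H psi).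
Proof.
rewrite {1}/chi FopE rmorphB !fmorph_div /= !Rop_chi invrN mulrNN; ring.
Qed.

Lemma TRop_Fop f :
  TRop (Fop H psi f) = chit H f / chit H psi - TRop (chi f) / TRop (chi psi).
Proof.
by rewrite FopE [TRop (_ / _ - _ / _)]rmorphB 2!fmorph_div /= !TRop_chit.
Qed.

(** The new beta carries the factors S [chi psi] and 1 / [chit H psi], so
    that, up to factors of [chit H f] and [chit H psi], the left side is the
    difference of [alpha_beta_chi] for the seed and for f; the constant g
    cancels. *)
Lemma chit_Fop mu f : biApp H f = cst K mu * f ->
  chit (biStep H psi) (Fop H psi f)
  = cst K (mu - mu1) * chit H f / chit H psi.
Proof.
move=> fE; have abE := alpha_beta_chi fE; have abE1 := alpha_beta_chi psiE.
have Sc0 : TRop (chi psi) != 0 by rewrite fmorph_eq0.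
rewrite {1}/chit TRop_Fop FopE /= fmorph_div !rmorphM /= !TRopK TRop_chit.
(* Split mu - mu1 into the constants of the two instances. *)
have -> : cst K (mu - mu1) * chit H f / chit H psi
  = (cst K (g - mu1) * chit H psi * chit H f / chit H psi
     - cst K (g - mu) * chit H f) / chit H psi.
  by rewrite !rmorphB /=; field.
rewrite -abE -abE1.
by field; rewrite chit0 chi0 Sc0.
Qed.

(** The values of [chit], [chi] and of the constants of the new operator are
    known; [chit_sub_Rop] for f and for the seed removes R [chit]. *)
Lemma biApp_Fop mu f : biApp H f = cst K mu * f ->
  biApp (biStep H psi) (Fop H psi f) = cst K mu * Fop H psi f.
Proof.
move=> fE; have ctE := chit_Fop fE; have cE := chi_Fop f.
have [_ bB gE] := biStep_balanced.
have Rt0 : Rop (chit H psi) != 0 by rewrite fmorph_eq0.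
have -> : forall H' u, biApp H' u = chit H' u - bi_alpha H' * chi u
    - (bi_beta H' + TRop (bi_beta H') - bi_gamma H') * u.
  by move=> H' u; rewrite /biApp /chit /chi; ring.
rewrite bB gE ctE cE FopE.
have /(canRL (subKr _)) RtE := chit_sub_Rop fE.
have /(canRL (subKr _)) Rt1E := chit_sub_Rop psiE.
rewrite /= mulrBr mulrCA [_ / _ * (_ / _)]mulrC mulrA.
have -> : Rop (chit H f) / Rop (chit H psi) * (Rop (chit H psi) / chi psi)
  = Rop (chit H f) / chi psi by field; rewrite chi0.
rewrite RtE Rt1E !(rmorphB, rmorphD) /=.
by field; rewrite chi0 chit0.
Qed.

(** By [chi_Fop] and [chit_Fop], two steps involve only the three functions
    t1, t2, t and their images under R. The term in mu1 arises from the
    coefficients mu2 - mu1 and mu - mu1 through the Pluecker-type relation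
    t2 (t Rt1 - Rt t1) - t (t2 Rt1 - Rt2 t1) = t1 (t Rt2 - Rt t2), which turns
    the numerator into the expansion of a 3 x 3 determinant. *)
Lemma two_steps mu2 psi2 mu f :
  let t1 := chit H psi in let t2 := chit H psi2 in let t := chit H f in
  let psi2' := Fop H psi psi2 in
  biApp H psi2 = cst K mu2 * psi2 -> biApp H f = cst K mu * f ->
  chi psi2' != 0 -> chit (biStep H psi) psi2' != 0 ->
  Fop (biStep H psi) psi2' (Fop H psi f)
  = (cst K mu * t * (t2 * Rop t1 - Rop t2 * t1)
     - cst K mu2 * t2 * (t * Rop t1 - Rop t * t1)
     + cst K mu1 * t1 * (t * Rop t2 - Rop t * t2))
    / (cst K (mu2 - mu1) * t2 * (t2 * Rop t1 - Rop t2 * t1)).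
Proof.
move=> t1 t2 t psi2' psi2E fE; rewrite FopE (chit_Fop fE) (chit_Fop psi2E).
rewrite !chi_Fop -/t1 -/t2 -/t => chi2 chit2.
have Rt1 : Rop t1 != 0 by rewrite fmorph_eq0.
have mu2_t2 : cst K (mu2 - mu1) * t2 != 0.
  by apply: contra_neq chit2 => ->; rewrite mul0r.
have W : t2 * Rop t1 - Rop t2 * t1 != 0.
  apply: contra_neq chi2 => W0.
  have -> : t2 / t1 - Rop t2 / Rop t1
    = (t2 * Rop t1 - Rop t2 * t1) / (t1 * Rop t1) by field; rewrite Rt1.
  by rewrite W0 mul0r.
move: mu2_t2; rewrite mulf_eq0 negb_or !rmorphB /= => /andP[dmu t20].
by field; rewrite Rt1 W dmu t20 ?chit0 /=.
Qed.

End Eigen.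

End Darboux.

(** * Iterated steps *)

Section Chain.
Variables (C : numFieldType) (K : functionField C) (H : biOp K).
Variables (A B g : C) (phi : nat -> K) (mu : nat -> C) (n : nat).
Hypothesis balH : balanced H A B g.
Hypothesis phiE : forall k, (1 <= k <= n)%N ->
  biApp H (phi k) = cst K (mu k) * phi k.
Hypothesis seed_neq0 : forall k, (1 <= k <= n)%N ->
  chiAt H phi k != 0 /\ chitAt H phi k != 0.

Lemma biHS k : biH H phi k.+1 = biStep (biH H phi k) (seed H phi k.+1).
Proof. by rewrite /biH /seed /biF /=; case: biChain. Qed.

Lemma biFS k f :
  biF H phi k.+1 f = Fop (biH H phi k) (seed H phi k.+1) (biF H phi k f).
Proof. by rewrite /biH /seed /biF /=; case: biChain. Qed.

(** The two facts are proved together: the step keeps the operator balanced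
    only because the transformed seed is an eigenfunction. *)
Lemma biChain_eigen k : (k <= n)%N ->
  (exists A' B' g', balanced (biH H phi k) A' B' g') /\
  forall nu f, biApp H f = cst K nu * f ->
    biApp (biH H phi k) (biF H phi k f) = cst K nu * biF H phi k f.
Proof.
elim: k => [|k IHk] kn; first by split=> //; exists A, B, g.
have [[A' [B' [g' bal]]] eig] := IHk (ltnW kn).
have [chi0 chit0] := seed_neq0 (k := k.+1) kn.
have psiE := eig _ _ (phiE (k := k.+1) kn).
rewrite biHS; split.
  by do 3 eexists; apply: (biStep_balanced bal psiE chi0 chit0).
move=> nu f fE; rewrite biFS.
by apply: (biApp_Fop bal psiE chi0 chit0); apply: eig.
Qed.

(** The denominator G, a product of the chi-tilde functions of the seeds used
    so far, is the same for all f; it therefore cancels in ratios. *)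
Lemma chit_biChain k : (k <= n)%N ->
  exists2 G : K, G != 0 & forall nu f, biApp H f = cst K nu * f ->
    chit (biH H phi k) (biF H phi k f)
    = cst K (\prod_(1 <= j < k.+1) (nu - mu j)) * chit H f / G.
Proof.
elim: k => [|k IHk] kn.
  exists 1 => [|nu f _]; first exact: oner_neq0.
  by rewrite big_nil rmorph1 mul1r divr1.
have [G G0 tE] := IHk (ltnW kn).
have [[A' [B' [g' bal]]] eig] := biChain_eigen (ltnW kn).
have [chi0 chit0] := seed_neq0 (k := k.+1) kn.
have psiE := eig _ _ (phiE (k := k.+1) kn).
exists (G * chitAt H phi k.+1) => [|nu f fE]; first by rewrite mulf_neq0.
rewrite biHS biFS (chit_Fop bal psiE chi0 chit0 (eig _ _ fE)) (tE _ _ fE).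
rewrite [in RHS]big_nat_recr //= [cst K (_ * _)]rmorphM /= /chitAt /=.
by field; rewrite G0 chit0.
Qed.

End Chain.

(** * Small determinants and the Bannai-Ito operator *)

Lemma det_mxOfRows2 (F : fieldType) (a b c d : F) :
  \det (mxOfRows 2 2 [:: [:: a; b]; [:: c; d]]) = a * d - b * c.
Proof.
rewrite (expand_det_col _ ord0) !big_ord_recl big_ord0 /cofactor !det_mx11.
by rewrite !mxE /= /bump /=; ring.
Qed.

Lemma det_mxOfRows3 (F : fieldType) (a1 b1 c1 a2 b2 c2 a3 b3 c3 : F) :
  \det (mxOfRows 3 3 [:: [:: a1; b1; c1]; [:: a2; b2; c2]; [:: a3; b3; c3]])
  = a1 * (b2 * c3 - c2 * b3) - a2 * (b1 * c3 - c1 * b3)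
    + a3 * (b1 * c2 - c1 * b2).
Proof.
rewrite (expand_det_col _ ord0) !big_ord_recl big_ord0 /cofactor.
rewrite !(expand_det_col _ ord0) !big_ord_recl !big_ord0 /cofactor !det_mx11.
by rewrite !mxE /= /bump /=; ring.
Qed.

(** Alpha is a monic quadratic in x divided by -2x, so the even part of the
    quadratic cancels in alpha + R alpha and the linear part leaves a
    constant. The same holds for beta in the variable x + 1/2, whose sign
    S reverses. *)
Lemma bannaiIto_balanced (C : numFieldType) (K : functionField C)
    (rho1 rho2 r1 r2 : C) :
  balanced (bannaiIto K rho1 rho2 r1 r2) (rho1 + rho2) (- (r1 + r2)) 0.
Proof.
have x0 := var_neq0 K; have two0 := two_neq0 K; have y0 := var2_neq0 K.
split=> /=; last by rewrite rmorph0.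
- rewrite fmorph_div !rmorphM !rmorphB !rmorphD rmorphN rmorph_nat /=.
  rewrite !Rop_var !Rop_cst.
  by move: (var K) x0 => x x0; field; rewrite !oppr_eq0 two0 x0.
- rewrite fmorph_div !(rmorphM, rmorphB, rmorphD, rmorphN) /=.
  rewrite !rmorphV /= ?unitfE // rmorph_nat rmorph1 !TRop_var !TRop_cst.
  move: (var K) y0 => x y0.
  have -> : 2 * (- x - 1) + 1 = - (2 * x + 1) by ring.
  by field; rewrite oppr_eq0 two0 y0.
Qed.

Theorem theorem2p7 (C : numFieldType) (K : functionField C)
    (rho1 rho2 r1 r2 : C) (n : nat)
    (phi : nat -> K) (mu : nat -> C) (phim : K) (mum : C) :
  rho1 \is Num.real -> rho2 \is Num.real ->
  r1 \is Num.real -> r2 \is Num.real ->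
  (2 <= n)%N ->
  let H := bannaiIto K rho1 rho2 r1 r2 in
  (forall k, (1 <= k <= n)%N -> eigenfunction H (mu k) (phi k)) ->
  (forall j k, (1 <= j <= n)%N -> (1 <= k <= n)%N -> j <> k -> mu j <> mu k) ->
  (forall k, (1 <= k <= n)%N ->
     chiAt H phi k != 0 /\ chitAt H phi k != 0) ->
  eigenfunction H mum phim ->
  let tm := chit H phim in
  let tn := chit H (phi n) in
  let tp := chit H (phi n.-1) in
  biApp (biH H phi n) (biF H phi n phim) = cst K mum * biF H phi n phim /\
  biF H phi n phim =
    (\prod_(1 <= j < n.-1) cst K ((mum - mu j) / (mu n - mu j)))
    * \det (mxOfRows 3 3
        [:: [:: cst K mum * tm; tm; Rop tm];
            [:: cst K (mu n) * tn; tn; Rop tn];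
            [:: cst K (mu n.-1) * tp; tp; Rop tp]])
    * (cst K (mu n - mu n.-1) * tn
       * \det (mxOfRows 2 2 [:: [:: tn; Rop tn]; [:: tp; Rop tp]]))^-1.
Proof.
move=> _ _ _ _ n2 H phiE mu_inj seed0 [_ phimE] tm tn tp.
have {}phiE k (kn : (1 <= k <= n)%N) := (phiE k kn).2.
have balH : balanced H _ _ _ := bannaiIto_balanced K rho1 rho2 r1 r2.
split; first by apply: (biChain_eigen balH phiE seed0 (leqnn n)).2.
(* N is the number of steps before the last two. *)
case: n n2 => [|[|N]] // _ in phiE mu_inj seed0 tn tp *.
have N2 : (N.+2 <= N.+2)%N by []; have N1 := leqnSn N.+1.
rewrite /= in tp *.
have [[A [B [g bal]]] eig] := biChain_eigen balH phiE seed0 (ltnW N1).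
have [G G0 tE] := chit_biChain balH phiE seed0 (ltnW N1).
have [chi1 chit1] := seed0 N.+1 N1.
have [chi2 chit2] := seed0 N.+2 N2.
have pE := phiE N.+1 N1; have nE := phiE N.+2 N2.
have seedE k : seed H phi k.+1 = biF H phi k (phi k.+1) by [].
rewrite /chiAt seedE biFS seedE in chi2.
rewrite /chitAt /= biHS !seedE biFS seedE in chit2.
rewrite !biFS biHS !seedE biFS seedE.
rewrite (two_steps bal (eig _ _ pE) chi1 chit1 (eig _ _ nE) (eig _ _ phimE)
  chi2 chit2).
(* Of the products that occur, only the one for phim may vanish. *)
have P_neq0 i : (N < i <= N.+2)%N ->
    cst K (\prod_(1 <= j < N.+1) (mu i - mu j)) != 0.
  move=> /andP[Ni iN]; rewrite fmorph_eq0 prodf_seq_neq0; apply/allP => j.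
  rewrite mem_index_iota subr_eq0 => /andP[j1 jN]; apply/eqP/mu_inj.
  - by rewrite iN (leq_ltn_trans _ Ni).
  - by rewrite j1 (leq_trans (ltnW jN)) ?N1.
  - by move=> ij; move: jN; rewrite -ij ltnNge Ni.
have Pp0 := P_neq0 N.+1; rewrite leqnn N1 in Pp0; move/(_ isT): Pp0 => Pp0.
have Pn0 := P_neq0 N.+2; rewrite N1 N2 in Pn0; move/(_ isT): Pn0 => Pn0.
rewrite -rmorph_prod prodf_div fmorph_div det_mxOfRows3 det_mxOfRows2.
rewrite (tE _ _ pE) (tE _ _ nE) (tE _ _ phimE) -/tm -/tn -/tp.
have RE (P : C) t : Rop (cst K P * t / G) = cst K P * Rop t / Rop G.
  by rewrite fmorph_div rmorphM /= Rop_cst.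
have RG0 : Rop G != 0 by rewrite fmorph_eq0.
rewrite !RE /=.
move: (cst K (\prod_(1 <= j < N.+1) (mu N.+1 - mu j))) Pp0 => Pp Pp0.
move: (cst K (\prod_(1 <= j < N.+1) (mu N.+2 - mu j))) Pn0 => Pn Pn0.
move: (cst K (\prod_(1 <= j < N.+1) (mum - mu j))) => Pm.
move: tm tn tp (Rop tm) (Rop tn) (Rop tp) (Rop G) RG0.
move=> tm tn tp tm' tn' tp' G' G'0; rewrite -[RHS]mulrA.
set num := (X in _ = _ * (X / _)); set den := (X in _ = _ * (_ / X)).
(* The factor Pn * Pp / (G^2 * RG) is common to numerator and denominator. *)
have -> : Pm / Pn = (Pm * (Pn * Pp / (G ^+ 2 * G')))
                    / (Pn * (Pn * Pp / (G ^+ 2 * G'))).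
  by field; rewrite G0 G'0 Pp0 Pn0.
rewrite [RHS]mulf_div.
by congr (_ / _); rewrite /num /den; field; rewrite G0 G'0.
Qed.
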